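(* Assume there is a constant $B_p$ such that for all large enough $n$, $\|\mathcal{F}^{(j)}\phi_n\|_{L^\infty(S^{(j)})}\le B_p\|\boldsymbol\omega_n\|_2^p$ for each $j\in\{1,\dots,N_S\}$. Also assume $\{\|\boldsymbol\omega_n\|_2^p d_n^{-1/2}\}_{n=1}^\infty\in\ell^2$. Let the point clouds and interpolation data be fixed, with $\tilde N$ the total number of Hermite-Birkhoff interpolation conditions. Let $\tilde b_\infty\in\ell^2$ be the solution of the full problem: minimize $\|b\|_{\ell^2}$ over $b\in\ell^2$ subject to $$\sum_{n=1}^\infty d_n^{-1/2}b_n(\mathcal{F}^{(j)}\phi_n)(\boldsymbol{x}^{(j)}_k)=f^{(j)}(\boldsymbol{x}^{(j)}_k)\quad\text{for all } j,k,$$ and set $\tilde u_\infty:=\sum_{n=1}^\infty d_n^{-1/2}\tilde b_{\infty,n}\phi_n\in\mathcal{H}(d)$. For $N_b\in\mathbb{N}$ let $\tilde{\boldsymbol b}\in\mathbb{C}^{N_b}$ be the solution of the finite basis problem: minimize $\|\boldsymbol b\|_2$ over $\boldsymbol b\in\mathbb{C}^{N_b}$ subject to $\mathcal{L}_{N_b}\boldsymbol b=\mathrm{proj}_{\mathcal{R}(\mathcal{L}_{N_b})}\boldsymbol f$, and set $\tilde u_{N_b}:=\sum_{n=1}^{N_b}d_n^{-1/2}\tilde b_n\phi_n$. Then there exists a constant $A_{\tilde N}>0$ (independent of $N_b$) such that for all sufficiently large $N_b$, $$\|\tilde u_\infty-\tilde u_{N_b}\|_{L^\infty(\Omega)}\le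 A_{\tilde N}\Big(\sum_{n=N_b+1}^\infty\|\boldsymbol\omega_n\|_2^{2p}d_n^{-1}\Big)^{1/2}.$$
   Context: $\Omega\subset\mathbb{R}^m$ is a box-shaped domain, and $\{\phi_n\}_{n=1}^\infty$ is the Fourier basis of $\Omega$ with periodic boundary conditions, $\phi_n(\boldsymbol{x})=e^{i\boldsymbol{\omega}_n\cdot\boldsymbol{x}}$, where $\{\boldsymbol\omega_n\}$ enumerates the frequencies of the box. $d=\{d_n\}_{n=1}^\infty$ is a sequence with each $d_n>0$. The Hilbert space $\mathcal{H}(d)$ is $\{\sum_{n=1}^\infty d_n^{-1/2}b_n\phi_n: b\in\ell^2\}$ with norm $\|\sum_n d_n^{-1/2}b_n\phi_n\|_d:=\|b\|_{\ell^2}$. The sets $S^{(j)}\subset\Omega$, $j\in\{1,\dots,N_S\}$, are manifolds, open bulk domains, or single points, and $\{\boldsymbol{x}_k^{(j)}\}_{k=1}^{\tilde N_j}\subseteq S^{(j)}$ are finite point clouds; $\tilde N=\sum_j\tilde N_j$. Each $\mathcal{F}^{(j)}$ is a linear differential operator of order at most $p\in\mathbb{N}$, $\mathcal F^{(j)}=\sum_{|\alpha|\le p}c_{j,\alpha}\partial^\alpha$, with bounded coefficient functions and with $\partial^\alpha$ the usual partial derivatives in $\mathbb{R}^m$; the coefficient functions and $f^{(j)}$ are defined in a neighbourhood of each point of $S^{(j)}$. The interpolation conditions are assumed consistent, i.e. the feasible set of the full $\ell^2$ problem is non-empty. $\boldsymbol f\in\mathbb{C}^{\tilde N}$ is the column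 vector of all values $f^{(j)}(\boldsymbol{x}_k^{(j)})$ over all $j,k$. The linear map $\mathcal{L}_{N_b}:\mathbb{C}^{N_b}\to\mathbb{C}^{\tilde N}$ is given by $(\mathcal{L}_{N_b}\boldsymbol b)_{(j,k)}=\sum_{n=1}^{N_b}d_n^{-1/2}b_n(\mathcal{F}^{(j)}\phi_n)(\boldsymbol{x}^{(j)}_k)$; $\mathcal{R}(\mathcal{L}_{N_b})$ is its range and $\mathrm{proj}$ denotes orthogonal projection. *)

(* Defs.v *)
(* All sequences are indexed from 0, so that the n-th term here is the
   (n+1)-st term of a sequence indexed by n = 1, 2, ...; "the first N terms"
   are those with index n < N and the tail after them is N <= n. *)
From HB Require Import structures.
From mathcomp Require Export all_boot all_order all_algebra spectral complex.
From mathcomp Require Export all_classical all_reals all_analysis.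
Export Order.TTheory GRing.Theory Num.Theory.
Export numFieldNormedType.Exports.

Set Implicit Arguments.
Unset Strict Implicit.
Unset Printing Implicit Defensive.

Local Open Scope classical_set_scope.
Local Open Scope complex_scope.
Local Open Scope ring_scope.

(* The complex numbers with the topology of the modulus; the library has it on
   every abstract numClosedFieldType, but does not find it on R[i]. *)
HB.instance Definition _ (R : realType) := GRing.ComAlgebra.copy R[i] R[i]^o.
HB.instance Definition _ (R : realType) := Vector.copy R[i] R[i]^o.
HB.instance Definition _ (R : realType) := NormedModule.copy R[i] R[i]^o.

Section Norms.
Context {R : realType}.

(* `|z| is an element of R[i]; this is its real value. *)
Definition cabs (z : R[i]) : R := Normc.normc z.

(* The norm of the library on 'rV[R]_m is the max norm, not this one. *)
Definition enorm m (w : 'rV[R]_m) : R := Num.sqrt (\sum_(i < m) w 0 i ^+ 2).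

Definition vnorm2 N (b : 'cV[R[i]]_N) : R :=
  Num.sqrt (\sum_(n < N) cabs (b n 0) ^+ 2).

Definition l2 (b : nat -> R[i]) : Prop :=
  cvgn (series (fun n => cabs (b n) ^+ 2)).

Definition l2norm (b : nat -> R[i]) : R :=
  Num.sqrt (limn (series (fun n => cabs (b n) ^+ 2))).

(* The L^oo norm as an actual supremum: the sets in use may be single points
   or manifolds, and the functions are evaluated pointwise. *)
Definition supnorm m (A : set 'rV[R]_m) (g : 'rV[R]_m -> R[i]) : \bar R :=
  ereal_sup [set (cabs (g x))%:E | x in A].

End Norms.

Section Fourier.
Context {R : realType} {m : nat}.
Implicit Types (a b w x : 'rV[R]_m).

Definition box a b : set 'rV[R]_m :=
  [set x | forall i, a 0 i < x 0 i < b 0 i].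

Definition box_freqs a b : set 'rV[R]_m :=
  [set w | exists k : 'rV[int]_m,
     forall i, w 0 i = 2 * pi * (k 0 i)%:~R / (b 0 i - a 0 i)].

Definition fourier w x : R[i] :=
  let t := \sum_(i < m) w 0 i * x 0 i in cos t +i* sin t.

End Fourier.

Section DifferentialOperators.
Context {R : realType} {m : nat}.

Definition pderiv (i : 'I_m) (g : 'rV[R]_m -> R[i]) : 'rV[R]_m -> R[i] :=
  fun x => 'D_(delta_mx 0 i) (fun y => complex.Re (g y)) x
        +i* 'D_(delta_mx 0 i) (fun y => complex.Im (g y)) x.

(* multi-indices alpha with |alpha| <= p; each component is then at most p *)
Definition mindex (p : nat) :=
  {al : {ffun 'I_m -> 'I_p.+1} | (\sum_(i < m) al i <= p)%N}.

Definition mderiv p (al : mindex p) (g : 'rV[R]_m -> R[i]) :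
    'rV[R]_m -> R[i] :=
  foldr (fun i h => iter (val al i) (pderiv i) h) g (enum 'I_m).

Definition diffop p (c : mindex p -> 'rV[R]_m -> R[i])
    (g : 'rV[R]_m -> R[i]) : 'rV[R]_m -> R[i] :=
  fun x => \sum_(al : mindex p) c al x * mderiv al g x.

End DifferentialOperators.

Arguments mindex : clear implicits.

Section Interpolation.
Context {R : realType} {m : nat}.
Variables (d : nat -> R) (om : nat -> 'rV[R]_m).

(* d_n^{-1/2} *)
Definition dinv n : R[i] := ((Num.sqrt (d n))^-1)%:C.

Definition synth (b : nat -> R[i]) : 'rV[R]_m -> R[i] :=
  fun x => limn (series (fun n => dinv n * b n * fourier (om n) x)).

Definition synth_fin N (b : 'cV[R[i]]_N) : 'rV[R]_m -> R[i] :=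
  fun x => \sum_(n < N) dinv n * b n 0 * fourier (om n) x.

Variables (NS p : nat) (c : 'I_NS -> mindex m p -> 'rV[R]_m -> R[i]).
Variables (Nt : 'I_NS -> nat) (x : forall j, 'I_(Nt j) -> 'rV[R]_m).
Variable f : 'I_NS -> 'rV[R]_m -> R[i].

Definition feasible (b : nat -> R[i]) : Prop :=
  forall (j : 'I_NS) (k : 'I_(Nt j)),
    series (fun n => dinv n * b n * diffop (c j) (fourier (om n)) (x k))
      @ \oo --> f j (x k).

Definition full_solution (b : nat -> R[i]) : Prop :=
  [/\ l2 b, feasible b &
      forall b', l2 b' -> feasible b' -> l2norm b <= l2norm b'].

(* The entries are indexed by the pairs (j, k), blockwise. *)
Definition data_vec : 'cV[R[i]]_(\sum_(j < NS) Nt j) :=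
  \mxcol_(j < NS) \col_(k < Nt j) f j (x k).

Definition Lmx N : 'M[R[i]]_(\sum_(j < NS) Nt j, N) :=
  \mxcol_(j < NS) \matrix_(k < Nt j, n < N)
    (dinv n * diffop (c j) (fourier (om n)) (x k)).

(* Orthogonal projection onto the range (column space) of A.  The library's
   proj_ortho is the matrix, acting on row vectors from the right, of the
   projection onto a row space, for the Hermitian product. *)
Definition range_proj q N (A : 'M[R[i]]_(q, N)) (y : 'cV[R[i]]_q) :
    'cV[R[i]]_q :=
  (y^T *m proj_ortho A^T)^T.

Definition finite_solution N (b : 'cV[R[i]]_N) : Prop :=
  let L := Lmx N in
  L *m b = range_proj L data_vec /\
  forall b' : 'cV[R[i]]_N,
    L *m b' = range_proj L data_vec -> vnorm2 b <= vnorm2 b'.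

End Interpolation.

(* Main.v *)
Require Import Defs.
From mathcomp Require Import ring.

Set Implicit Arguments.
Unset Strict Implicit.
Unset Printing Implicit Defensive.

Local Open Scope classical_set_scope.
Local Open Scope complex_scope.
Local Open Scope ring_scope.

(** Write [alpha n] for the vector of the values of the n-th weighted basis
    function in all interpolation conditions, [t n] for
    |omega_n|^p d_n^(-1/2), [tau N] for the sum of the [t n ^+ 2] with N <= n,
    and b for the solution of the full problem.  The entries of [alpha n] are
    O(t n).

    The conditions take values in a finite-dimensional space, so the range of
    the truncated map stops growing at some N0 and all the [alpha n] lie in it
    ([stable_range]).  This gives one right inverse [P], supported on the first
    N0 coefficients, which serves every N >= N0.  The data vector is a limit of
    combinations of the [alpha n], hence lies in the range as well
    ([meas_sol_data]), and the projection in the finite problem leaves it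
    unchanged.

    The solution b is minimal with infinitely many coefficients free, so each
    of its truncations has minimal norm among the vectors with the same finite
    measurements ([minnorm_prefix]), and is therefore orthogonal to the kernel
    ([minnorm_orth]).  Testing this orthogonality on e_n - P (alpha n), which
    is in the kernel, expresses b_n through the first N0 coefficients and
    yields |b_n| = O(t n) ([optimal_decay]).  Consequently the truncation of b
    misses the data by sum_(n >= N) b_n (alpha n) = O(tau N).

    The truncation of b and the solution of the finite problem are both
    orthogonal to the kernel, and so is their difference, which is thus the
    shortest vector with its own measurements; correcting the residual by [P]
    shows that its norm is O(tau N) ([truncation_error]).

    Finally the frequencies are pairwise distinct points of a lattice, so all
    but one are bounded away from 0, whence d_n^(-1/2) = O(t n) for large n.
    The difference of the two interpolants is at most
    sum_(n < N) d_n^(-1/2) |difference of the coefficients|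
    + sum_(n >= N) d_n^(-1/2) |b_n|; both parts are O(tau N), the first by
    Cauchy-Schwarz and the second by the decay of b.  The bound O(tau N) is
    stronger than the claim, as tau N <= sqrt (tau 0) * sqrt (tau N). *)

(** * Complex modulus and dominated series *)

Section Modulus.
Context {R : realType}.
Implicit Types z w : R[i].

Lemma normC_cabs z : `|z| = (cabs z)%:C.
Proof. by []. Qed.

Lemma cabs_ge0 z : 0 <= cabs z.
Proof. by rewrite -ler0c -normC_cabs normr_ge0. Qed.

Lemma cabsD z w : cabs (z + w) <= cabs z + cabs w.
Proof. exact: le_normcD. Qed.

Lemma cabsM z w : cabs (z * w) = cabs z * cabs w.
Proof. exact: Normc.normcM. Qed.

Lemma cabs0 : cabs (0 : R[i]) = 0.
Proof. exact: Normc.normc0. Qed.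

Lemma cabsN z : cabs (- z) = cabs z.
Proof. exact: normcN. Qed.

Lemma cabs_real (r : R) : 0 <= r -> cabs r%:C = r.
Proof. by move=> r0; rewrite /cabs /= expr0n addr0 sqrtr_sqr ger0_norm. Qed.

Lemma cabs2E z : cabs z ^+ 2 = complex.Re z ^+ 2 + complex.Im z ^+ 2.
Proof.
by case: z => x y; rewrite /cabs /= sqr_sqrtr // addr_ge0 ?sqr_ge0.
Qed.

Lemma cabs_sum (I : Type) (r : seq I) (P : pred I) (F : I -> R[i]) :
  cabs (\sum_(i <- r | P i) F i) <= \sum_(i <- r | P i) cabs (F i).
Proof.
elim/big_ind2 : _ => //; first by rewrite cabs0.
by move=> z r1 w r2 h1 h2; rewrite (le_trans (cabsD _ _)) ?lerD.
Qed.

Lemma Re_le_cabs z : `|complex.Re z| <= cabs z.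
Proof.
rewrite -(@ler_pXn2r _ 2) ?nnegrE ?cabs_ge0 // cabs2E real_normK ?num_real //.
by rewrite lerDl sqr_ge0.
Qed.

Lemma Im_le_cabs z : `|complex.Im z| <= cabs z.
Proof.
rewrite -(@ler_pXn2r _ 2) ?nnegrE ?cabs_ge0 // cabs2E real_normK ?num_real //.
by rewrite lerDr sqr_ge0.
Qed.

Lemma cabs_le_ReIm z : cabs z <= `|complex.Re z| + `|complex.Im z|.
Proof.
rewrite -(@ler_pXn2r _ 2) ?nnegrE ?cabs_ge0 ?addr_ge0 // cabs2E sqrrD.
by rewrite !real_normK ?num_real // lerD2r lerDl mulrn_wge0 ?mulr_ge0.
Qed.

(** The topology on the complex numbers is metrised by a norm with complex
    values; this brings convergence back to real radii. *)
Lemma cvgn_cabsP (u : nat -> R[i]) (l : R[i]) :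
  u @ \oo --> l <->
  forall e : R, 0 < e -> \forall n \near \oo, cabs (l - u n) < e.
Proof.
split=> [/cvgrPdist_lt ul e e0|ul].
  have e0' : 0 < e%:C by rewrite ltcR.
  by apply: filterS (ul _ e0') => n; rewrite normC_cabs ltcR.
apply/cvgrPdist_lt => -[e e'] /[dup]; rewrite {1}ltcE /= => /andP[/eqP-> e0] _.
by apply: filterS (ul _ e0) => n; rewrite normC_cabs ltcR.
Qed.

(** Completeness is used only on the real line: the real and the imaginary
    parts converge absolutely, and the limit is assembled from theirs. *)
Lemma cvgn_dominated (u : nat -> R[i]) (t : nat -> R) (C : R) (N : nat) :
  (forall n, 0 <= t n) -> 0 <= C ->
  (forall n, (N <= n)%N -> cabs (u n) <= C * t n) ->
  cvgn (series t) -> cvgn (series u).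
Proof.
move=> t0 C0 ut ct.
(* [g] stands for the real part or the imaginary part. *)
have part (g : R[i] -> R) : (forall z, `|g z| <= cabs z) ->
    cvgn (series (g \o u)).
  move=> gz; apply: normed_cvg; apply: nondecreasing_is_cvgn.
    by apply: nondecreasing_series => n _ _; rewrite normr_ge0.
  exists (\sum_(0 <= k < N) `|g (u k)| + C * limn (series t)) => _ [n _ <-].
  apply: (@le_trans _ _ (\sum_(0 <= k < N + n) `|g (u k)|)).
    rewrite /series /= (@big_cat_nat _ _ _ n 0 (N + n)) ?leq_addl //=.
    by rewrite lerDl sumr_ge0.
  rewrite (@big_cat_nat _ _ _ N) ?leq_addr //= lerD2l.
  apply: (@le_trans _ _ (\sum_(N <= k < N + n) C * t k)).
    rewrite !big_nat ler_sum // => k /andP[Nk _].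
    exact: le_trans (gz _) (ut _ Nk).
  rewrite -mulr_sumr ler_wpM2l //
    (le_trans _ (nondecreasing_cvgn_le _ ct (N + n))) //.
    rewrite /series /= (@big_cat_nat _ _ _ N 0 (N + n)) ?leq_addr //=.
    by rewrite lerDr sumr_ge0.
  by apply: nondecreasing_series => k _ _.
have /cvg_ex[x /cvgrPdist_lt cx] := part _ Re_le_cabs.
have /cvg_ex[y /cvgrPdist_lt cy] := part _ Im_le_cabs.
apply/cvg_ex; exists (x +i* y); apply/cvgn_cabsP => e e0.
have e20 : 0 < e / 2 by rewrite divr_gt0.
near=> n.
rewrite (le_lt_trans (cabs_le_ReIm _)) // [ltRHS]splitr ltrD //.
  rewrite raddfB /= /series /= (raddf_sum (@complex.Re R : Rcomplex R -> R)).
  by near: n; exact: cx.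
rewrite raddfB /= /series /= (raddf_sum (@complex.Im R : Rcomplex R -> R)).
by near: n; exact: cy.
Unshelve. all: by end_near. Qed.

Lemma series_tail_le (u : nat -> R[i]) (l : R[i]) (t : nat -> R) (C : R)
    (N : nat) :
  (forall n, 0 <= t n) -> 0 <= C ->
  (forall n, (N <= n)%N -> cabs (u n) <= C * t n) ->
  cvgn (series t) -> series u @ \oo --> l ->
  cabs (l - series u N) <= C * (limn (series t) - series t N).
Proof.
move=> t0 C0 ut ct /cvgn_cabsP ul; apply/ler_addgt0Pr => e e0.
have [n [nN ln]] : exists n, (N <= n)%N /\ cabs (l - series u n) < e.
  near \oo => n; exists n; split; near: n; first exact: nbhs_infty_ge.
  exact: ul.
have -> : l - series u N = (series u n - series u N) + (l - series u n).
  by rewrite [RHS]addrC subrKA.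
rewrite (le_trans (cabsD _ _)) // lerD //; last exact: ltW.
rewrite sub_series_geq //.
rewrite (le_trans (cabs_sum _ _ _)) //.
apply: (@le_trans _ _ (\sum_(N <= k < n) C * t k)).
  by rewrite !big_nat ler_sum // => k /andP[Nk _]; exact: ut.
rewrite -mulr_sumr ler_wpM2l // -sub_series_geq // lerD2r.
by apply: nondecreasing_cvgn_le => //; apply: nondecreasing_series => k _ _.
Unshelve. all: by end_near. Qed.

End Modulus.

(** * Minimal-norm vectors under finitely many linear conditions *)

Section MinimalNorm.
Context {R : realType} {I : Type} (al : nat -> I -> R[i]).
Implicit Types (N : nat) (u v w g : nat -> R[i]).

Definition meas N u (i : I) : R[i] := \sum_(k < N) u k * al k i.

Definition nsq N u : R := \sum_(k < N) cabs (u k) ^+ 2.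

Definition minnorm N u :=
  forall v, (forall i, meas N v i = meas N u i) -> nsq N u <= nsq N v.

(** The real part of the Hermitian product.  Orthogonality for it suffices
    below, because the kernel of [meas] is also a real subspace. *)
Definition rdot N u v : R :=
  \sum_(k < N) (complex.Re (u k) * complex.Re (v k)
                + complex.Im (u k) * complex.Im (v k)).

Lemma nsq_ge0 N u : 0 <= nsq N u.
Proof. by apply: sumr_ge0 => k _; exact: sqr_ge0. Qed.

Lemma nsq_line N u g (t : R) :
  nsq N (fun k => u k + t%:C * g k) =
  nsq N u + (2 * t * rdot N u g + t ^+ 2 * nsq N g).
Proof.
rewrite /nsq /rdot !mulr_sumr -!big_split /=; apply: eq_bigr => k _.
rewrite !cabs2E; case: (u k) => a b; case: (g k) => c e /=.
by ring.
Qed.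

Lemma measD N u v i : meas N (u \+ v) i = meas N u i + meas N v i.
Proof. by rewrite -big_split; apply: eq_bigr => k _; rewrite mulrDl. Qed.

Lemma measZ N z u i : meas N (fun k => z * u k) i = z * meas N u i.
Proof. by rewrite mulr_sumr; apply: eq_bigr => k _; rewrite mulrA. Qed.

Lemma measB N u v i : meas N (u \- v) i = meas N u i - meas N v i.
Proof. by rewrite -sumrB; apply: eq_bigr => k _; rewrite mulrBl. Qed.

(** First variation: along the line u + t g inside the fibre of u the squared
    norm is a quadratic polynomial in t, minimal at 0. *)
Lemma minnorm_orth N u g :
  minnorm N u -> (forall i, meas N g i = 0) -> rdot N u g = 0.
Proof.
move=> umin g0.
have pos t : 0 <= 2 * t * rdot N u g + t ^+ 2 * nsq N g.
  rewrite -(lerD2l (nsq N u)) addr0 -nsq_line; apply: umin => i.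
  by rewrite (measD _ u) measZ g0 mulr0 addr0.
set x := rdot N u g in pos *; set y := nsq N g in pos.
have y0 : 0 <= y by exact: nsq_ge0.
have y1 : 0 < y + 1 by rewrite ltr_wpDl.
(* The denominator y + 1 avoids a separate case for y = 0. *)
have := pos (- x / (y + 1)).
have -> : 2 * (- x / (y + 1)) * x + (- x / (y + 1)) ^+ 2 * y
  = - (x ^+ 2 * ((y + 2) / (y + 1) ^+ 2)) by field; rewrite gt_eqF.
rewrite oppr_ge0 pmulr_lle0 ?divr_gt0 ?exprn_gt0 ?ltr_wpDl //.
by move=> x2; apply/eqP; rewrite -sqrf_eq0 eq_le x2 sqr_ge0.
Qed.

(** Being orthogonal to the kernel is preserved by differences and
    characterises minimality, by Pythagoras; so u - v is the shortest vector
    with its measurements. *)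
Lemma minnormB N u v w : minnorm N u -> minnorm N v ->
  (forall i, meas N w i = meas N u i - meas N v i) ->
  nsq N (u \- v) <= nsq N w.
Proof.
move=> umin vmin wE; set g := w \- (u \- v).
have g0 i : meas N g i = 0 by rewrite !measB wE subrr.
have orth : rdot N (u \- v) g = 0.
  have -> : rdot N (u \- v) g = rdot N u g - rdot N v g.
    rewrite /rdot -sumrB; apply: eq_bigr => k _.
    by rewrite !raddfB /=; ring.
  by rewrite !minnorm_orth ?subrr.
have -> : nsq N w = nsq N (fun k => (u \- v) k + 1%:C * g k).
  by apply: eq_bigr => k _; rewrite mul1r /= addrC subrK.
by rewrite nsq_line orth mulr0 add0r lerDl mulr_ge0 ?sqr_ge0 ?nsq_ge0.
Qed.

Lemma rdot_le N u v : rdot N u v <= \sum_(k < N) cabs (u k) * cabs (v k).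
Proof.
apply: ler_sum => k _; rewrite -cabsM.
have -> : cabs (u k * v k) = cabs ((u k)^* * v k).
  by rewrite !cabsM; congr (_ * _); case: (u k) => a b; rewrite /cabs /= sqrrN.
apply: le_trans (le_trans (ler_norm _) (Re_le_cabs _)).
by case: (u k) => a b; case: (v k) => c e /=; rewrite mulNr opprK.
Qed.

(** A vector with the same first N measurements as [b] can replace the first N
    coefficients of [b] without changing the limit of any condition; the
    squared norm then changes by a finite difference, nonnegative because [b]
    is optimal. *)
Lemma minnorm_prefix (b : nat -> R[i]) (f : I -> R[i]) N :
  l2 b ->
  (forall i, series (fun n => b n * al n i) @ \oo --> f i) ->
  (forall b', l2 b' ->
     (forall i, series (fun n => b' n * al n i) @ \oo --> f i) ->
     l2norm b <= l2norm b') ->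
  minnorm N b.
Proof.
move=> lb fb bmin v vE.
pose b' k := if (k < N)%N then v k else b k.
(* [F z n] is |z|^2 for the norms and z * al n i for the conditions. *)
have split (V : zmodType) (F : R[i] -> nat -> V) K : (N <= K)%N ->
    series (fun n => F (b' n) n) K
    = series (fun n => F (b n) n) K
      + (\sum_(k < N) F (v k) k - \sum_(k < N) F (b k) k).
  move=> NK; rewrite /series /= !(@big_cat_nat _ _ _ N 0 K) //= !big_mkord.
  have -> : \sum_(k < N) F (b' k) k = \sum_(k < N) F (v k) k.
    by apply: eq_bigr => k _; rewrite /b' ltn_ord.
  have -> : \sum_(N <= k < K) F (b' k) k = \sum_(N <= k < K) F (b k) k.
    by rewrite !big_nat; apply: eq_bigr => k /andP[Nk _]; rewrite /b' ltnNge Nk.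
  by rewrite [RHS]addrC addrA subrK.
have sq : series (fun n => cabs (b' n) ^+ 2) @ \oo
    --> limn (series (fun n => cabs (b n) ^+ 2)) + (nsq N v - nsq N b).
  apply: (@cvg_trans _
    ((fun K => series (fun n => cabs (b n) ^+ 2) K
               + (nsq N v - nsq N b)) @ \oo)).
    apply: near_eq_cvg; near=> K.
    by rewrite (split _ (fun z _ => cabs z ^+ 2)) //; near: K;
      exact: nbhs_infty_ge.
  by apply: cvgD => //; exact: cvg_cst.
have lb' : l2 b' by apply/cvg_ex; eexists; exact: sq.
have := bmin b' lb'.
rewrite /l2norm (cvg_lim _ sq) // ler_sqrt; last first.
  rewrite -(cvg_lim _ sq) //; apply: limr_ge => //.
  by near=> K; apply: sumr_ge0 => k _; exact: sqr_ge0.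
rewrite lerDl subr_ge0; apply => i.
apply: cvg_trans (fb i); apply: near_eq_cvg; near=> K.
rewrite (split _ (fun z n => z * al n i)); last first.
  by near: K; exact: nbhs_infty_ge.
by have := vE i; rewrite /meas => ->; rewrite subrr addr0.
Unshelve. all: by end_near. Qed.

End MinimalNorm.

Lemma sum_prefix (V : nmodType) (F : nat -> V) (n N : nat) : (n <= N)%N ->
  (forall k, (n <= k)%N -> F k = 0) -> \sum_(k < N) F k = \sum_(k < n) F k.
Proof.
move=> nN F0; rewrite -!(big_mkord xpredT F) (@big_cat_nat _ _ _ n) //=.
rewrite [X in _ + X]big_nat [X in _ + X]big1 ?addr0 // => k /andP[nk _].
exact: F0.
Qed.

Section StableRange.
Context {R : realType} {Q : nat} (al : nat -> 'I_Q -> R[i]).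

(** The ranks of the matrices formed by the first N vectors are bounded, so
    some N0 attains the largest rank; from then on the range cannot grow and
    contains every [al n].  The pseudo-inverse at N0, extended by 0, is a right
    inverse on that range for every later N. *)
Lemma stable_range : exists N0 (P : nat -> 'I_Q -> R[i]),
  (forall k q, (N0 <= k)%N -> P k q = 0) /\
  forall N n i, (N0 <= N)%N ->
    meas al N (fun k => \sum_q P k q * al n q) i = al n i.
Proof.
pose A N : 'M[R[i]]_(N, Q) := \matrix_(k, q) al k q.
have A_sub N M : (N <= M)%N -> (A N <= A M)%MS.
  move=> NM; apply/row_subP => k.
  have -> : row k (A N) = row (widen_ord NM k) (A M).
    by apply/rowP => q; rewrite !mxE.
  exact: row_sub.
pose has r := `[< exists N, \rank (A N) = r >].
have exr : exists r, has r by exists (\rank (A 0%N)); apply/asboolP; exists 0%N.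
have bnd r : has r -> (r <= Q)%N by move=> /asboolP[N <-]; exact: rank_leq_col.
case: (ex_maxnP exr bnd) => r /asboolP[N0 rN0] rmax.
have alA n : (\row_q al n q <= A N0)%MS.
  have le0 : (N0 <= maxn N0 n.+1)%N by rewrite leq_maxl.
  have : (A N0 == A (maxn N0 n.+1))%MS.
    rewrite -(mxrank_leqif_eq (A_sub _ _ le0)) rN0 eqn_leq rmax ?andbT.
      by rewrite -rN0 mxrankS // A_sub.
    by apply/asboolP; eexists.
  move=> /eqmxP ->.
  have ltn : (n < maxn N0 n.+1)%N by rewrite leq_max ltnSn orbT.
  have -> : \row_q al n q = row (Ordinal ltn) (A (maxn N0 n.+1)).
    by apply/rowP => q; rewrite !mxE.
  exact: row_sub.
pose P k q := if insub k is Some k0 then pinvmx (A N0) q k0 else 0.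
have P0 k q : (N0 <= k)%N -> P k q = 0.
  by move=> Nk; rewrite /P insubF // ltnNge Nk.
exists N0, P; split=> // N n i NN; pose F k := (\sum_q P k q * al n q) * al k i.
rewrite /meas (sum_prefix (n := N0) (F := F)) //; last first.
  by move=> k Nk; rewrite /F big1 ?mul0r // => q _; rewrite P0 ?mul0r.
have /rowP/(_ i) := mulmxKpV (alA n); rewrite !mxE => <-.
apply: eq_bigr => k _; rewrite /F !mxE; congr (_ * _).
by apply: eq_bigr => q _; rewrite /P valK !mxE mulrC.
Qed.

End StableRange.

(** * Coefficients of the optimum and of its truncations *)

Section Truncation.
Context {R : realType} {Q : nat}.
Variables (al : nat -> 'I_Q -> R[i]) (b : nat -> R[i]) (f : 'I_Q -> R[i]).
Variables (N0 : nat) (P : nat -> 'I_Q -> R[i]).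

(** The correction whose measurements are [v], for [v] in the range: [P] is a
    right inverse of the measurements such as [stable_range] provides. *)
Definition sol (v : 'I_Q -> R[i]) k : R[i] := \sum_q P k q * v q.

Definition rowsum k : R := \sum_q cabs (P k q).

Hypothesis P0 : forall k q, (N0 <= k)%N -> P k q = 0.
Hypothesis PK : forall N n i, (N0 <= N)%N -> meas al N (sol (al n)) i = al n i.
Hypothesis fb : forall i, series (fun n => b n * al n i) @ \oo --> f i.

Lemma rowsum_ge0 k : 0 <= rowsum k.
Proof. by apply: sumr_ge0 => q _; exact: cabs_ge0. Qed.

Lemma sol_supp v k : (N0 <= k)%N -> sol v k = 0.
Proof. by move=> Nk; rewrite /sol big1 // => q _; rewrite P0 ?mul0r. Qed.

Lemma sol_le v (be : R) k : (forall q, cabs (v q) <= be) ->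
  cabs (sol v k) <= rowsum k * be.
Proof.
move=> vb; rewrite (le_trans (cabs_sum _ _ _)) // mulr_suml.
by apply: ler_sum => q _; rewrite cabsM ler_wpM2l ?cabs_ge0.
Qed.

Lemma nsq_sol_le v (be : R) N : (N0 <= N)%N -> (forall q, cabs (v q) <= be) ->
  nsq N (sol v) <= (\sum_(k < N0) rowsum k ^+ 2) * be ^+ 2.
Proof.
move=> NN vb; rewrite /nsq (sum_prefix (F := fun k => cabs (sol v k) ^+ 2) NN).
  rewrite mulr_suml; apply: ler_sum => k _; rewrite -exprMn.
  have h := sol_le k vb.
  by rewrite ler_pXn2r // nnegrE ?cabs_ge0 // (le_trans (cabs_ge0 _) h).
by move=> k Nk; rewrite sol_supp // cabs0 expr0n.
Qed.

Lemma meas_solE N v i :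
  meas al N (sol v) i = \sum_q (\sum_(k < N) P k q * al k i) * v q.
Proof.
under [RHS]eq_bigr do rewrite mulr_suml.
rewrite [RHS]exchange_big; apply: eq_bigr => k _.
by rewrite mulr_suml; apply: eq_bigr => q _; rewrite mulrAC.
Qed.

(** The right inverse works for each [al n], hence for finite combinations of
    them and, the sum over q being finite, for the limit [f] of such
    combinations. *)
Lemma meas_sol_data N i : (N0 <= N)%N -> meas al N (sol f) i = f i.
Proof.
move=> NN; rewrite meas_solE; pose G q := \sum_(k < N) P k q * al k i.
have lim : (fun K => \sum_q G q * series (fun n => b n * al n q) K) @ \oo
    --> \sum_q G q * f q.
  apply: cvg_big => [|q _]; first exact: add_continuous.
  apply: cvgM; [exact: cvg_cst|exact: (@fb q)].
have eqs : (fun K => \sum_q G q * series (fun n => b n * al n q) K)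
    = series (fun n => b n * al n i).
  apply/funext => K; rewrite /series /=.
  under eq_bigr do rewrite mulr_sumr.
  rewrite exchange_big; apply: eq_bigr => n _; rewrite -(PK n i NN) meas_solE.
  by rewrite mulr_sumr; apply: eq_bigr => q _; rewrite mulrCA.
rewrite eqs in lim.
have hs : hausdorff_space R[i] by exact: norm_hausdorff.
exact: (cvg_unique hs lim (@fb i)).
Qed.

Lemma meas_sol_residual N i : (N0 <= N)%N ->
  meas al N (sol (fun q => f q - meas al N b q)) i = f i - meas al N b i.
Proof.
move=> NN; rewrite meas_solE.
under eq_bigr do rewrite mulrBr.
rewrite sumrB -meas_solE meas_sol_data //; congr (_ - _).
under eq_bigr do rewrite mulr_sumr.
rewrite exchange_big; apply: eq_bigr => k _; rewrite -(PK k i NN) meas_solE.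
by rewrite mulr_sumr; apply: eq_bigr => q _; rewrite mulrCA.
Qed.

(** The vector e_n - sol (al n) is in the kernel, so <b, e_n> = <b, sol (al n)>;
    the right-hand side involves only the first N0 coefficients and is bounded
    by a fixed multiple of the size of [al n]. *)
Lemma optimal_decay n (be : R) : (N0 <= n)%N -> minnorm al n.+1 b ->
  (forall q, cabs (al n q) <= be) ->
  cabs (b n) <= (\sum_(k < N0) cabs (b k) * rowsum k) * be.
Proof.
move=> Nn bmin alb.
have [->|bn0] := eqVneq (b n) 0.
  rewrite cabs0 mulr_suml sumr_ge0 // => k _.
  rewrite -mulrA mulr_ge0 ?cabs_ge0 //.
  exact: le_trans (cabs_ge0 _) (sol_le k alb).
have Nn1 : (N0 <= n.+1)%N by exact: leqW.
(* The factor b_n turns the real part of the product with e_n into |b_n|^2. *)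
pose g k := b n * ((k == n)%:R - sol (al n) k).
have g0 i : meas al n.+1 g i = 0.
  rewrite measZ (measB _ _ (fun k => (k == n)%:R)) PK // /meas big_ord_recr /=.
  rewrite eqxx mul1r big1 ?add0r ?subrr ?mulr0 // => k _.
  by rewrite (ltn_eqF (ltn_ord k)) mul0r.
have := minnorm_orth bmin g0.
have -> : rdot n.+1 b g
    = cabs (b n) ^+ 2 - rdot n.+1 b (fun k => b n * sol (al n) k).
  rewrite /rdot !big_ord_recr /= opprD addrA addrAC -sumrN.
  have -> : cabs (b n) ^+ 2 = complex.Re (b n) * complex.Re (b n)
     + complex.Im (b n) * complex.Im (b n) by rewrite cabs2E !expr2.
  rewrite /g eqxx !mulrBr mulr1 !raddfB /= !mulrBr.
  rewrite [in LHS](_ : \sum_(k < n) _ = - \sum_(k < n)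
     (complex.Re (b k) * complex.Re (b n * sol (al n) k)
      + complex.Im (b k) * complex.Im (b n * sol (al n) k))); last first.
    rewrite -sumrN; apply: eq_bigr => k _.
    by rewrite (ltn_eqF (ltn_ord k)) !mulrBr mulr0 !raddfB !raddf0 /=; ring.
  by rewrite sumrN; ring.
move=> /eqP; rewrite subr_eq0 => /eqP bE.
have bn : 0 < cabs (b n).
  rewrite lt_def cabs_ge0 andbT; apply: contra bn0.
  by move=> /eqP/Normc.eq0_normc ->.
rewrite -(ler_pM2l bn) -expr2 bE (le_trans (rdot_le _ _ _)) //.
rewrite (sum_prefix (F := fun k => cabs (b k) * cabs (b n * sol (al n) k)) Nn1);
  last first.
  by move=> k Nk; rewrite sol_supp // mulr0 cabs0 mulr0.
rewrite mulr_suml mulr_sumr; apply: ler_sum => k _.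
rewrite cabsM mulrCA -mulrA !ler_wpM2l ?cabs_ge0 //.
exact: sol_le.
Qed.

(** Both [u] and the truncation of [b] are minimal, so their difference is no
    longer than any vector with the same measurements, in particular than the
    image of the residual under the right inverse. *)
Lemma truncation_error N u (be : R) : (N0 <= N)%N ->
  minnorm al N u -> minnorm al N b -> (forall i, meas al N u i = f i) ->
  (forall q, cabs (f q - meas al N b q) <= be) ->
  nsq N (u \- b) <= (\sum_(k < N0) rowsum k ^+ 2) * be ^+ 2.
Proof.
move=> NN umin bmin uf eb; apply: le_trans (nsq_sol_le NN eb).
by apply: (minnormB umin bmin) => i; rewrite meas_sol_residual // uf.
Qed.

End Truncation.

(** * Real estimates and the frequency lattice *)

Section Estimates.
Context {R : realType}.

Lemma eseries_tail (u : nat -> R) N : cvgn (series u) ->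
  (\sum_(N <= n <oo) (u n)%:E = (limn (series u) - series u N)%:E)%E.
Proof.
move=> cu; apply: cvg_lim => //.
apply: (@cvg_trans _ ((fun n => (series u n - series u N)%:E) @ \oo)).
  apply: near_eq_cvg; near=> n.
  by rewrite sumEFin sub_series_geq //; near: n; exact: nbhs_infty_ge.
apply: cvg_EFin; first exact: nearW.
by apply: cvgB => //; exact: cvg_cst.
Unshelve. all: by end_near. Qed.

(** A Cauchy-Schwarz estimate with the larger constant S + 1 in place
    of sqrt S, which keeps square roots out of the later constants. *)
Lemma sum_mul_le (s w : nat -> R) (S be : R) N :
  0 <= be ->
  \sum_(n < N) s n ^+ 2 <= S -> \sum_(n < N) w n ^+ 2 <= be ^+ 2 ->
  \sum_(n < N) s n * w n <= (S + 1) * be.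
Proof.
move=> be0 sS wbe.
have S0 : 0 <= S by apply: le_trans sS; apply: sumr_ge0 => n _; exact: sqr_ge0.
have [be_eq0|ben0] := eqVneq be 0.
  rewrite be_eq0 mulr0 big1 // => n _.
  have : w n ^+ 2 == 0.
    rewrite eq_le sqr_ge0 andbT; rewrite be_eq0 expr0n /= in wbe.
    apply: le_trans wbe; rewrite (bigD1 n) //= lerDl.
    by apply: sumr_ge0 => k _; exact: sqr_ge0.
  by rewrite sqrf_eq0 => /eqP ->; rewrite mulr0.
have be_gt0 : 0 < be by rewrite lt_def ben0.
(* Termwise arithmetic-geometric inequality, balanced with weight be. *)
apply: (@le_trans _ _ (\sum_(n < N) (be * s n ^+ 2 + be^-1 * w n ^+ 2))).
  apply: ler_sum => n _; rewrite -subr_ge0.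
  have -> : be * s n ^+ 2 + be^-1 * w n ^+ 2 - s n * w n
    = be^-1 * ((be * s n - w n / 2) ^+ 2 + 3 / 4 * w n ^+ 2) by field.
  by rewrite mulr_ge0 ?invr_ge0 // addr_ge0 ?sqr_ge0 // mulr_ge0 ?sqr_ge0.
rewrite big_split -!mulr_sumr /= [leRHS]mulrDl mul1r mulrC lerD //.
  by rewrite ler_wpM2r.
by rewrite mulrC ler_pdivrMr // -expr2.
Qed.

Lemma enorm_ge0 m (w : 'rV[R]_m) : 0 <= enorm w.
Proof. exact: sqrtr_ge0. Qed.

Lemma coord_le_enorm m (w : 'rV[R]_m) i : `|w 0 i| <= enorm w.
Proof.
rewrite -sqrtr_sqr ler_wsqrtr // (bigD1 i) //= lerDl.
by apply: sumr_ge0 => k _; exact: sqr_ge0.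
Qed.

Lemma cabs_fourier m (w y : 'rV[R]_m) : cabs (fourier w y) = 1.
Proof. by rewrite /fourier /cabs /= cos2Dsin2 sqrtr1. Qed.

(** A nonzero frequency has a component 2 pi k_i / (b_i - a_i) with k_i a
    nonzero integer, so [rho] can be the sum of all (b_i - a_i) / (2 pi).  The
    zero frequency occurs at most once since the enumeration is injective. *)
Lemma freqs_bounded_below m (a b : 'rV[R]_m) (om : nat -> 'rV[R]_m) :
  (forall i, a 0 i < b 0 i) -> set_bij [set: nat] (box_freqs a b) om ->
  exists2 rho : R, 0 <= rho &
    \forall n \near \oo, 1 <= rho * enorm (om n).
Proof.
move=> hab [om_freq om_inj _].
have len i : 0 < b 0 i - a 0 i by rewrite subr_gt0.
have pi2 : 0 < 2 * pi :> R by rewrite mulr_gt0 ?pi_gt0.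
exists (\sum_i (b 0 i - a 0 i) / (2 * pi)).
  by apply: sumr_ge0 => i _; rewrite divr_ge0 // ltW.
have far n : om n != 0 ->
    1 <= (\sum_i (b 0 i - a 0 i) / (2 * pi)) * enorm (om n).
  move=> omn; have [i wi] : exists i, om n 0 i != 0.
    apply/existsP; rewrite -[X in is_true X]negbK negb_exists.
    apply: contra omn => /forallP om0; apply/eqP/rowP => i; rewrite mxE.
    exact/eqP/negPn/om0.
  have [k /(_ i) kE] := om_freq n I.
  rewrite (bigD1 i) //= mulrDl ler_wpDr //.
    rewrite mulr_ge0 ?enorm_ge0 // sumr_ge0 // => l _.
    by rewrite divr_ge0 // ltW.
  have fac : 0 < (b 0 i - a 0 i) / (2 * pi) by rewrite divr_gt0.
  apply: le_trans (_ : (b 0 i - a 0 i) / (2 * pi) * `|om n 0 i| <= _);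
    last first.
    by rewrite ler_pM2l // coord_le_enorm.
  rewrite -[X in X * _]gtr0_norm // -normrM.
  have -> : (b 0 i - a 0 i) / (2 * pi) * om n 0 i = (k 0 i)%:~R.
    rewrite kE; have := pi_gt0 R; move: pi => P P0; field.
    by rewrite (gt_eqF (len i)) (gt_eqF P0).
  have -> : `|(k 0 i)%:~R : R| = (`|k 0 i|)%:~R by rewrite intr_norm.
  rewrite ler1z -gtz0_ge1 normr_gt0.
  by apply: contra wi => /eqP k0; rewrite kE k0 mulr0 mul0r.
have [[n0 omn0]|no0] := pselect (exists n, om n = 0).
  near=> n; apply: far; apply/eqP => omn.
  have : n = n0 by apply: om_inj; rewrite ?in_setT // omn.
  by apply/eqP; rewrite gtn_eqF //; near: n; exact: nbhs_infty_gt.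
by near=> n; apply: far; apply/eqP => omn; apply: no0; exists n.
Unshelve. all: by end_near. Qed.

End Estimates.

(** * The interpolation problem *)

Section Conditions.
Context {R : realType} {m : nat}.
Variables (d : nat -> R) (om : nat -> 'rV[R]_m) (NS p : nat).
Variables (c : 'I_NS -> mindex m p -> 'rV[R]_m -> R[i]) (Nt : 'I_NS -> nat).
Variables (x : forall j, 'I_(Nt j) -> 'rV[R]_m) (f : 'I_NS -> 'rV[R]_m -> R[i]).

Local Notation Q := (\sum_(j < NS) Nt j)%N.

Definition node (q : 'I_Q) : 'rV[R]_m := x (tagnat.sig2 q).

Definition alpha n (q : 'I_Q) : R[i] :=
  dinv d n * diffop (c (tagnat.sig1 q)) (fourier (om n)) (node q).

Definition data (q : 'I_Q) : R[i] := f (tagnat.sig1 q) (node q).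

(** Passes from the pairs (j, k) of a set and one of its nodes to the single
    index that the block matrix of the conditions uses. *)
Lemma feasibleP u : feasible d om c x f u <->
  forall q, series (fun n => u n * alpha n q) @ \oo --> data q.
Proof.
have swap j y : (fun n => dinv d n * u n * diffop (c j) (fourier (om n)) y)
    = (fun n => u n * (dinv d n * diffop (c j) (fourier (om n)) y)).
  by apply/funext => n; rewrite [X in X * _]mulrC mulrA.
split=> [uf q|uf j k].
  by have := uf _ (tagnat.sig2 q); rewrite swap.
(* The statement is phrased on the pair, so that the round trip through the
   single index rewrites without a dependent transport. *)
pose T (s : {j & 'I_(Nt j)}) :=
  series (fun n => u n * (dinv d n
     * diffop (c (tag s)) (fourier (om n)) (x (tagged s)))) @ \oo
  --> f (tag s) (x (tagged s)).
have : T (tagnat.sig (tagnat.rank (Tagged (fun j => 'I_(Nt j)) k))).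
  exact: (uf (tagnat.rank (Tagged (fun j => 'I_(Nt j)) k))).
by rewrite tagnat.rankK /T /= swap.
Qed.

Lemma Lmx_meas N (v : 'cV[R[i]]_N) (u : nat -> R[i]) q :
  (forall n : 'I_N, v n 0 = u n) ->
  (Lmx d om c x N *m v) q 0 = meas alpha N u q.
Proof.
move=> vu; rewrite mxE /meas; apply: eq_bigr => n _.
by rewrite !mxE vu mulrC.
Qed.

(** Once the data are attained by some [w], their projection onto the range
    is the data themselves, and a finite solution is an exact interpolant of
    minimal norm. *)
Lemma finite_solution_minnorm N (bN : 'cV[R[i]]_N) w :
  (forall q, meas alpha N w q = data q) ->
  finite_solution d om c x f bN ->
  exists u : nat -> R[i], [/\ forall n : 'I_N, bN n 0 = u n,
    forall q, meas alpha N u q = data q & minnorm alpha N u].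
Proof.
move=> wdata [].
have Lw : Lmx d om c x N *m (\col_n w n) = data_vec x f.
  apply/colP => q; rewrite (Lmx_meas (u := w)) ?wdata; last first.
    by move=> n; rewrite mxE.
  by rewrite !mxE.
have -> : range_proj (Lmx d om c x N) (data_vec x f) = data_vec x f.
  rewrite /range_proj proj_ortho_id ?trmxK // -Lw trmx_mul; exact: submxMl.
move=> bdata bmin.
pose u n : R[i] := if insub n is Some n0 then bN n0 0 else 0.
have bu (n : 'I_N) : bN n 0 = u n by rewrite /u valK.
have udata q : meas alpha N u q = data q.
  by rewrite -(Lmx_meas (v := bN)) // bdata !mxE.
exists u; split=> // v vu.
have := bmin (\col_n v n); rewrite /vnorm2 ler_sqrt; last first.
  by apply: sumr_ge0 => n _; exact: sqr_ge0.
have -> : \sum_(n < N) cabs (bN n 0) ^+ 2 = nsq N u.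
  by apply: eq_bigr => n _; rewrite bu.
have -> : \sum_(n < N) cabs ((\col_n v n : 'cV_N) n 0) ^+ 2 = nsq N v.
  by apply: eq_bigr => n _; rewrite mxE.
apply; apply/colP => q; rewrite (Lmx_meas (u := v)) ?vu ?udata ?mxE //.
by move=> n; rewrite mxE.
Qed.

(** The basis functions have modulus 1, so the error at any point is bounded
    by the weighted l1 distance of the coefficients: Cauchy-Schwarz handles
    the first N, and the others are dominated by the tail of [t]. *)
Lemma synth_error (b u : nat -> R[i]) (t : nat -> R) (S C be : R) N
    (bN : 'cV[R[i]]_N) y :
  (forall n, 0 <= t n) -> cvgn (series t) -> 0 <= C -> 0 <= be ->
  (forall n, (N <= n)%N -> cabs (dinv d n) * cabs (b n) <= C * t n) ->
  (forall n : 'I_N, bN n 0 = u n) ->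
  \sum_(n < N) cabs (dinv d n) ^+ 2 <= S -> nsq N (u \- b) <= be ^+ 2 ->
  cabs (synth d om b y - synth_fin d om bN y)
    <= (S + 1) * be + C * (limn (series t) - series t N).
Proof.
move=> t0 ct C0 be0 bt bu sS ub.
pose F n := dinv d n * b n * fourier (om n) y.
have Ft n : (N <= n)%N -> cabs (F n) <= C * t n.
  by move=> Nn; rewrite !cabsM cabs_fourier mulr1 bt.
have cF : cvgn (series F) by exact: (cvgn_dominated t0 C0 Ft).
have tail := series_tail_le t0 C0 Ft ct cF.
have -> : synth d om b y - synth_fin d om bN y
    = (series F N - synth_fin d om bN y) + (synth d om b y - series F N).
  by rewrite [RHS]addrC subrKA.
apply: le_trans (cabsD _ _) _; apply: lerD; last exact: tail.
have -> : series F N - synth_fin d om bN y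
    = \sum_(n < N) dinv d n * (b n - u n) * fourier (om n) y.
  rewrite /series /= big_mkord /synth_fin -sumrB; apply: eq_bigr => n _.
  by rewrite /F bu mulrBr mulrBl.
apply: le_trans (cabs_sum _ _ _) _.
under eq_bigr do rewrite !cabsM cabs_fourier mulr1.
apply: (sum_mul_le (s := fun n => cabs (dinv d n))
  (w := fun n => cabs (b n - u n))) => //.
apply: le_trans ub; apply: ler_sum => n _.
by rewrite -cabsN opprB.
Qed.

End Conditions.

Theorem proposition9 (R : realType) (m : nat)
  (a b : 'rV[R]_m) (hab : forall i, a 0 i < b 0 i)
  (om : nat -> 'rV[R]_m) (hom : set_bij [set: nat] (box_freqs a b) om)
  (d : nat -> R) (hd : forall n, 0 < d n)
  (NS p : nat)
  (S : 'I_NS -> set 'rV[R]_m) (hS : forall j, S j `<=` box a b)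
  (Nt : 'I_NS -> nat) (x : forall j, 'I_(Nt j) -> 'rV[R]_m)
  (hx : forall j k, S j (x j k))
  (D : 'I_NS -> set 'rV[R]_m) (hD : forall j y, S j y -> nbhs y (D j))
  (c : 'I_NS -> mindex m p -> 'rV[R]_m -> R[i])
  (hc : forall j al, exists M : R, forall y, D j y -> cabs (c j al y) <= M)
  (f : 'I_NS -> 'rV[R]_m -> R[i])
  (hcons : exists2 beta : nat -> R[i], l2 beta & feasible d om c x f beta)
  (B : R)
  (hB : \forall n \near \oo, forall j,
      (supnorm (S j) (diffop (c j) (fourier (om n)))
         <= (B * enorm (om n) ^+ p)%:E)%E)
  (hsum : l2 (fun n => (enorm (om n) ^+ p / Num.sqrt (d n))%:C))
  (binf : nat -> R[i]) (hbinf : full_solution d om c x f binf) :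
  exists2 A : R, 0 < A &
    \forall N \near \oo, forall bN : 'cV[R[i]]_N,
      finite_solution d om c x f bN ->
      (supnorm (box a b) (fun y => (synth d om binf y - synth_fin d om bN y)%R)
         <= A%:E * sqrte (\sum_(N <= n <oo)
                            (enorm (om n) ^+ (2 * p) / d n)%:E))%E.
Proof.
pose t n : R := enorm (om n) ^+ p / Num.sqrt (d n).
pose t2 n : R := t n ^+ 2.
have t0 n : 0 <= t n by rewrite divr_ge0 ?sqrtr_ge0 ?exprn_ge0 ?enorm_ge0.
have t20 n : 0 <= t2 n by exact: sqr_ge0.
have t2E n : enorm (om n) ^+ (2 * p) / d n = t2 n.
  by rewrite /t2 expr_div_n -exprM mulnC sqr_sqrtr // ltW.
have ct2 : cvgn (series t2).
  have -> // : t2 = (fun n => cabs (t n)%:C ^+ 2).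
  by apply/funext => n; rewrite cabs_real.
have dinvE n : cabs (dinv d n) = (Num.sqrt (d n))^-1.
  by rewrite cabs_real ?invr_ge0 ?sqrtr_ge0.
pose tau N := limn (series t2) - series t2 N.
have series_le N : series t2 N <= limn (series t2).
  by apply: nondecreasing_cvgn_le => //; apply: nondecreasing_series => k _ _.
have tau0 N : 0 <= tau N by rewrite subr_ge0.
have tauT N : tau N <= limn (series t2) by rewrite gerBl; exact: sumr_ge0.
have [binf_l2 /feasibleP bdata binf_min] := hbinf.
have bmin N : minnorm (alpha d om c x) N binf.
  apply: minnorm_prefix bdata _ => // b' l2b' fb'.
  by apply: binf_min => //; apply/feasibleP.
have [N0 [P [P0 PK]]] := stable_range (alpha d om c x).
have [rho rho0 [n1 _ hrho]] := freqs_bounded_below hab hom.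
have dinv_le n : (n1 <= n)%N -> cabs (dinv d n) <= rho ^+ p * t n.
  move=> /hrho le1; by rewrite dinvE /t mulrA -exprMn ler_peMl ?exprn_ege1 //.
case: hB => n2 _ hn2.
have alpha_le n q : (n2 <= n)%N -> cabs (alpha d om c x n q) <= `|B| * t n.
  move=> /hn2/(_ (tagnat.sig1 q)) sup.
  have le : cabs (diffop (c (tagnat.sig1 q)) (fourier (om n)) (node x q))
      <= `|B| * enorm (om n) ^+ p.
    apply: (@le_trans _ _ (B * enorm (om n) ^+ p)).
      rewrite -lee_fin; apply: le_trans sup; apply: ereal_sup_ubound.
      by exists (node x q) => //; exact: hx.
    by rewrite ler_wpM2r ?ler_norm // exprn_ge0 ?enorm_ge0.
  by rewrite cabsM dinvE mulrC /t mulrA ler_wpM2r // invr_ge0 sqrtr_ge0.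
(* [K], [W], [V] do not depend on N: the decay constant of the optimum, the
   squared size of the right inverse, and a bound on the sums of 1 / d_n. *)
pose K := (\sum_(k < N0) cabs (binf k) * rowsum P k) * `|B|.
have K0 : 0 <= K.
  rewrite mulr_ge0 // sumr_ge0 // => k _.
  by rewrite mulr_ge0 ?cabs_ge0 ?rowsum_ge0.
have decay n : (maxn N0 n2 <= n)%N -> cabs (binf n) <= K * t n.
  rewrite geq_max => /andP[N0n n2n]; rewrite /K -mulrA.
  by apply: optimal_decay (bmin _) _ => // q; exact: alpha_le.
pose W := \sum_(k < N0) rowsum P k ^+ 2.
have W0 : 0 <= W by apply: sumr_ge0 => k _; exact: sqr_ge0.
pose V := \sum_(k < n1) cabs (dinv d k) ^+ 2
          + (rho ^+ p) ^+ 2 * limn (series t2).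
have V0 : 0 <= V.
  apply: addr_ge0; first by apply: sumr_ge0 => k _; exact: sqr_ge0.
  by rewrite mulr_ge0 ?sqr_ge0 // (le_trans (tau0 0%N)).
pose A := (V + 1) * ((W + 1) * (K * `|B|)) + rho ^+ p * K.
have W1 : 0 <= W + 1 by exact: addr_ge0 W0 ler01.
have V1 : 0 <= V + 1 by exact: addr_ge0 V0 ler01.
have rp0 : 0 <= rho ^+ p by rewrite exprn_ge0.
have A0 : 0 <= A.
  exact: addr_ge0 (mulr_ge0 V1 (mulr_ge0 W1 (mulr_ge0 K0 (normr_ge0 B))))
    (mulr_ge0 rp0 K0).
exists (A * Num.sqrt (limn (series t2)) + 1).
  by rewrite ltr_wpDl // mulr_ge0 // sqrtr_ge0.
near=> N => bN bN_sol.
have N0N : (N0 <= N)%N by near: N; exact: nbhs_infty_ge.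
have n1N : (n1 <= N)%N by near: N; exact: nbhs_infty_ge.
have n2N : (n2 <= N)%N by near: N; exact: nbhs_infty_ge.
have bt n : (N <= n)%N -> cabs (binf n) <= K * t n.
  by move=> Nn; apply: decay; rewrite geq_max !(leq_trans _ Nn).
have := finite_solution_minnorm
  (fun q => meas_sol_data PK bdata q N0N) bN_sol.
move=> [u [bu udata umin]].
have res q : cabs (data x f q - meas (alpha d om c x) N binf q)
    <= K * `|B| * tau N.
  have -> : meas (alpha d om c x) N binf q
      = series (fun n => binf n * alpha d om c x n q) N.
    by rewrite /series /= big_mkord.
  apply: series_tail_le (bdata q) => // [|n Nn]; first by rewrite mulr_ge0.
  rewrite cabsM (_ : K * _ * _ = (K * t n) * (`|B| * t n)); last first.
    by rewrite /t2; ring.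
  by rewrite ler_pM ?cabs_ge0 ?bt ?alpha_le // (leq_trans n2N).
have err : nsq N (u \- binf) <= ((W + 1) * (K * `|B| * tau N)) ^+ 2.
  apply: le_trans (truncation_error P0 PK bdata N0N umin (bmin N) udata res) _.
  rewrite [leRHS]exprMn ler_wpM2r ?sqr_ge0 // -/W expr2.
  rewrite -[leLHS]mulr1 ler_pM // ?lerDl ?lerDr //.
have dS : \sum_(n < N) cabs (dinv d n) ^+ 2 <= V.
  rewrite -(big_mkord xpredT (fun n => cabs (dinv d n) ^+ 2)).
  rewrite (@big_cat_nat _ _ _ n1) //= big_mkord lerD2l.
  apply: (@le_trans _ _ (\sum_(n1 <= n < N) (rho ^+ p) ^+ 2 * t2 n)).
    rewrite !big_nat; apply: ler_sum => n /andP[n1n _].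
    rewrite /t2 -exprMn ler_pXn2r ?nnegrE ?cabs_ge0 ?dinv_le //.
    by rewrite mulr_ge0 ?exprn_ge0.
  rewrite -mulr_sumr ler_wpM2l ?sqr_ge0 // -sub_series_geq //.
  by rewrite (le_trans _ (series_le N)) // gerBl; exact: sumr_ge0.
have be0 : 0 <= (W + 1) * (K * `|B| * tau N).
  exact: mulr_ge0 W1 (mulr_ge0 (mulr_ge0 K0 (normr_ge0 B)) (tau0 N)).
apply: ge_ereal_sup => _ [y _ <-].
under eq_eseriesr do rewrite t2E.
rewrite eseries_tail // -EFinM lee_fin -/(tau N).
have C0 : 0 <= rho ^+ p * K by exact: mulr_ge0.
have Ct n : (N <= n)%N ->
    cabs (dinv d n) * cabs (binf n) <= (rho ^+ p * K) * t2 n.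
  move=> Nn; rewrite (_ : _ * t2 n = (rho ^+ p * t n) * (K * t n)).
    by rewrite ler_pM ?cabs_ge0 ?bt ?dinv_le // (leq_trans n1N).
  by rewrite /t2; ring.
apply: le_trans (synth_error om y t20 ct2 C0 be0 Ct bu dS err) _.
rewrite -/(tau N) (_ : _ + _ = A * tau N); last by rewrite /A; ring.
rewrite [leRHS]mulrDl mul1r ler_wpDr ?sqrtr_ge0 // -mulrA ler_wpM2l //.
by rewrite -{1}(sqr_sqrtr (tau0 N)) expr2 ler_wpM2r ?sqrtr_ge0 ?ler_wsqrtr.
Unshelve. all: by end_near. Qed.
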